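(* Let $a\ge 2$ and $k\ge 1$ be integers. Consider the change of variables $$x_i = \frac{\xi_i^a(1+\xi_{i+1}^a)}{1+\xi_i^a},\qquad i\in\{1,\dots,k\},$$ with indices taken cyclically mod $k$, i.e. $\xi_{k+1}:=\xi_1$. Its Jacobian determinant is $$\det \frac{\partial(x_1,\dots,x_k)}{\partial(\xi_1,\dots,\xi_k)} = \begin{cases} a\,\xi_1^{a-1} & \text{if } k=1,\\[4pt] \dfrac{a^k(\xi_1\cdots\xi_k)^{a-1}}{(1+\xi_1^a)\cdots(1+\xi_k^a)}\bigl(1-(-1)^k(\xi_1\cdots\xi_k)^a\bigr) & \text{if } k\ge 2,\end{cases}$$ and the change of variables is a diffeomorphism between $(0,1)^k$ (the region of $(x_1,\dots,x_k)$) and $\mathbb{H}^k$ (the region of $(\xi_1,\dots,\xi_k)$); that is, the map $(\xi_1,\dots,\xi_k)\mapsto(x_1,\dots,x_k)$ is a diffeomorphism from $\mathbb{H}^k$ onto $(0,1)^k$.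
   Context: The hyperbolic polytope is $\mathbb{H}^k=\{(\xi_1,\dots,\xi_k)\in\mathbb{R}^k:\ \xi_i\xi_{i+1}<1,\ \xi_i>0,\ i\in\{1,\dots,k\}\}$, with $\xi_{k+1}:=\xi_1$ (so for $k=1$ the condition reads $\xi_1^2<1$, $\xi_1>0$). *)

(* Defs.v *)
From mathcomp Require Import all_boot all_order all_algebra.
From mathcomp Require Import all_classical all_reals all_analysis.
Set Implicit Arguments.
Unset Strict Implicit.
Unset Printing Implicit Defensive.
Import Order.TTheory GRing.Theory Num.Theory.
Import numFieldNormedType.Exports.
Local Open Scope classical_set_scope.
Local Open Scope ring_scope.

(* [ordS] is the cyclic successor of 'I_k, which encodes xi_(k+1) := xi_1. *)
Definition hyperbolic_polytope (R : realType) (k : nat) : set 'rV[R]_k :=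
  [set xi | forall i, xi 0 i * xi 0 (ordS i) < 1 /\ 0 < xi 0 i].

Definition open_unit_cube (R : realType) (k : nat) : set 'rV[R]_k :=
  [set x | forall i, 0 < x 0 i < 1].

Definition change_of_variables (R : realType) (a k : nat) (xi : 'rV[R]_k)
    : 'rV[R]_k :=
  \row_i (xi 0 i ^+ a * (1 + xi 0 (ordS i) ^+ a) / (1 + xi 0 i ^+ a)).

(* Meant for open U: [continuous], [differentiable] and ['D_v] refer to the
   ambient space. A differentiable f is of class C^(r+1) iff all its
   directional derivatives (equivalently, its partial ones) are of class C^r. *)
Fixpoint class_C (R : realType) (m n : nat) (r : nat) (U : set 'rV[R]_m)
    (f : 'rV[R]_m -> 'rV[R]_n) : Prop :=
  match r with
  | 0 => forall x, U x -> {for x, continuous f}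
  | r'.+1 => (forall x, U x -> differentiable f x) /\
             (forall v : 'rV[R]_m, class_C r' U ('D_v f))
  end.

Definition smooth_on (R : realType) (m n : nat) (U : set 'rV[R]_m)
    (f : 'rV[R]_m -> 'rV[R]_n) : Prop :=
  forall r : nat, class_C r U f.

(* f and g are total functions; their values outside U and V are irrelevant. *)
Definition diffeomorphism (R : realType) (m n : nat) (U : set 'rV[R]_m)
    (V : set 'rV[R]_n) (f : 'rV[R]_m -> 'rV[R]_n) : Prop :=
  [/\ open U, open V, set_bij U V f, smooth_on U f &
      exists2 g : 'rV[R]_n -> 'rV[R]_m,
        smooth_on V g & forall x, U x -> g (f x) = x].

(* Main.v *)
Require Import Defs.
From mathcomp Require Import all_boot all_order all_algebra.
From mathcomp Require Import all_classical all_reals all_analysis.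
From mathcomp Require Import ring lra.
Import Order.TTheory GRing.Theory Num.Theory.
Import numFieldNormedType.Exports.
Local Open Scope classical_set_scope.
Local Open Scope ring_scope.

(** With u_i = xi_i ^ a, the equations defining x read u_i = phi_i (u_(i+1))
    for the Moebius maps phi_i(t) = x_i / (1 - x_i + t). Hence u_i is a fixed
    point of phi_i o phi_(i+1) o ... o phi_(i+k-1), a Moebius map whose
    coefficients are nonnegative polynomials in x; its unique positive fixed
    point is given by the quadratic formula. Conversely phi_i maps the fixed
    point of index i+1 to the one of index i, so these fixed points solve the
    system. The inverse is thus given by an explicit formula, whose smoothness
    is visible without the inverse function theorem. The Jacobian matrix is
    cyclic bidiagonal. *)

(** * Determinant of a cyclic bidiagonal matrix *)

(** Expansion along column 0, where [d] contributes in the first row and [e] in the last; the two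
    minors are triangular with diagonals taken from [d] and [e]. Summing indicators covers [n = 0]
    too, where both contributions share the single entry. *)
Lemma det_cyclic_bidiagonal (K : comPzRingType) (n : nat) (d e : 'I_n.+1 -> K) :
  \det (\matrix_(i, j) ((i == j)%:R * d i + (j == ordS i)%:R * e i)) =
  \prod_i d i + (-1) ^+ n * \prod_i e i.
Proof.
set A := \matrix_(i, j) _.
have AE i j : A i j = (i == j)%:R * d i + (j == ordS i)%:R * e i.
  by rewrite /A mxE.
have ord0S (i : 'I_n.+1) : (ord0 == ordS i) = (i == ord_max).
  rewrite -!val_eqE /= eq_sym.
  have [->|in'] := eqVneq (i : nat) n; first by rewrite modnn.
  by rewrite modn_small // ltnS ltn_neqAle in' -ltnS ltn_ord.
rewrite (expand_det_col A ord0).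
under [LHS]eq_bigr => i _ do rewrite AE ord0S mulrDl.
rewrite big_split /= (bigD1 ord0) //= [X in _ + X + _]big1 ?addr0; last first.
  by move=> i /negPf ->; rewrite !mul0r.
rewrite [X in _ + X](bigD1 ord_max) //= [X in _ + (_ + X)]big1 ?addr0; last first.
  by move=> i /negPf ->; rewrite !mul0r.
rewrite !eqxx !mul1r /cofactor /= !addn0 expr0 mul1r; congr (_ + _).
- rewrite big_ord_recl; congr (_ * _).
  have entry i j : (row' ord0 (col' ord0 A)) i j =
      (i == j)%:R * d (lift ord0 i) + (j == i.+1 :> nat)%:R * e (lift ord0 i).
    rewrite !mxE (inj_eq lift_inj); congr (_ + _%:R * _).
    rewrite -val_eqE /= /bump /= !add1n.
    (* In the last row the cyclic successor wraps around to the deleted column 0. *)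
    have [iSn|iSn] := eqVneq (i.+1 : nat) n.
      by rewrite iSn modnn (ltn_eqF (ltn_ord j)).
    by rewrite modn_small // ltnS ltn_neqAle iSn ltn_ord.
  rewrite -det_tr det_trig; last first.
    apply/is_trig_mxP => i j ltij; rewrite mxE entry.
    by rewrite -val_eqE /= (gtn_eqF ltij) (ltn_eqF (leqW ltij)) !mul0r addr0.
  by apply: eq_bigr => i _; rewrite mxE entry eqxx ltn_eqF // mul1r mul0r addr0.
- rewrite big_ord_recr /= mulrCA [_ * e _]mulrC; congr (_ * _); congr (_ * _).
  have entry i j : (row' ord_max (col' ord0 A)) i j =
      (i == j.+1 :> nat)%:R * d (widen_ord (leqnSn n) i) +
      (i == j)%:R * e (widen_ord (leqnSn n) i).
    rewrite !mxE.
    have -> : lift ord_max i = widen_ord (leqnSn n) i.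
      by apply: val_inj; exact: lift_max.
    congr (_%:R * _ + _%:R * _).
    by rewrite -val_eqE /= /bump /= add1n modn_small ?ltnS ?ltn_ord // eqSS eq_sym.
  rewrite det_trig; last first.
    apply/is_trig_mxP => i j ltij; rewrite entry.
    by rewrite -val_eqE /= (ltn_eqF ltij) (ltn_eqF (leqW ltij)) !mul0r addr0.
  by apply: eq_bigr => i _; rewrite entry eqxx ltn_eqF // mul1r mul0r add0r.
Qed.

(** * Smoothness of functions built from coordinates by sums, products and real powers *)

(** The first-order expansion of [f] at [x] is also one of [g], and uniqueness of the differential
    identifies its linear part with ['d g x]. *)
Lemma near_eq_differentiable (K : numFieldType) (V W : normedModType K)
    (f g : V -> W) (x : V) :
  (\near x, f x = g x) -> differentiable f x -> differentiable g x.
Proof.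
move=> fg df; have fgx := nbhs_singleton fg.
have [dfc dfE] := (diff_locallyP x f).1 df.
have dgE : g \o shift x = cst (g x) + 'd f x +o_ 0 id.
  apply/eqaddoP => _/posnumP[e].
  move/eqaddoP : dfE => /(_ e%:num) /(_ [elaborate gt0 e]) dfE.
  have {}fg : \forall h \near 0, f (h + x) = g (h + x).
    rewrite (near_shift x) /=; near=> y.
    by rewrite /= sub0r subrK; near: y.
  apply: filterS2 fg dfE => h fgh.
  rewrite -[X in `|X|]/(f (h + x) - (f x + 'd f x h)) fgh fgx.
  exact.
apply/diff_locallyP.
by rewrite (diff_unique dfc dgE).
Unshelve. all: by end_near.
Qed.

Lemma differentiable_row (R : realType) (V : normedModType R) n
    (F : V -> 'rV[R]_n) (x : V) :
  (forall i, differentiable (fun y => F y 0 i) x) -> differentiable F x.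
Proof.
move=> dF.
have -> : F = \sum_(i < n) (fun y => F y 0 i *: delta_mx 0 i).
  by apply/funext => y; rewrite fct_sumE -row_sum_delta.
by apply: differentiable_sum => i; exact: differentiableZl.
Qed.

Lemma derive_coord (R : realType) m n (F : 'rV[R]_m -> 'rV[R]_n)
    (x v : 'rV[R]_m) (i : 'I_n) :
  differentiable F x -> ('D_v F x) 0 i = 'D_v (fun y => F y 0 i) x.
Proof. by move=> dF; rewrite derive_mx ?mxE //; exact: diff_derivable. Qed.

(* This class is stable under directional derivatives, which makes all its
   members smooth on open [U]. It contains inverses and square roots of positive
   members, as [powR] with exponents [-1] and [2^-1]. *)
Inductive elementary {R : realType} {m : nat} {U : set 'rV[R]_m} :
    ('rV[R]_m -> R) -> Prop :=
| elementary_cst c : elementary (fun=> c)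
| elementary_coord i : elementary (fun x => x 0 i)
| elementary_add f g :
    elementary f -> elementary g -> elementary (fun x => f x + g x)
| elementary_mul f g :
    elementary f -> elementary g -> elementary (fun x => f x * g x)
| elementary_powR f p : elementary f -> (forall x, U x -> 0 < f x) ->
    elementary (fun x => f x `^ p).
Arguments elementary {R m} U f.

Lemma derive_coordE (R : realType) m (i : 'I_m) (x v : 'rV[R]_m) :
  'D_v (fun y : 'rV[R]_m => y 0 i : R) x = v 0 i.
Proof.
rewrite -(@derive_coord R m m id) ?derive_id //.
Qed.

(** Induction on the formation rules, by the sum, product and chain rules. Derivatives are
    identified only on [U], where the bases of real powers are positive. *)
Lemma elementary_derive (R : realType) m (U : set 'rV[R]_m) f :
  elementary U f ->
  (forall x, U x -> differentiable f x) /\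
  forall v, exists2 g, elementary U g & forall x, U x -> 'D_v f x = g x.
Proof.
elim=> {f} [c|i|f g ef [df Df] eg [dg Dg]|f g ef [df Df] eg [dg Dg]
  |f p ef [df Df] fgt0].
- split=> [x _|v]; first exact: differentiable_cst.
  by exists (fun=> 0); [exact: elementary_cst|move=> x _; rewrite derive_cst].
- split=> [x _|v]; first exact: differentiable_coord.
  exists (fun=> v 0 i); first exact: elementary_cst.
  by move=> x _; rewrite derive_coordE.
- split=> [x Ux|v]; first exact: differentiableD (df x Ux) (dg x Ux).
  have [[f' ef' Df'] [g' eg' Dg']] := (Df v, Dg v).
  exists (fun x => f' x + g' x); first exact: elementary_add.
  move=> x Ux; rewrite -Df' // -Dg' //.
  by apply: deriveD; apply: diff_derivable; auto.
- split=> [x Ux|v]; first exact: differentiableM (df x Ux) (dg x Ux).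
  have [[f' ef' Df'] [g' eg' Dg']] := (Df v, Dg v).
  exists (fun x => f x * g' x + g x * f' x).
    by apply: elementary_add; apply: elementary_mul.
  move=> x Ux; rewrite -Df' // -Dg' //.
  by apply: deriveM; apply: diff_derivable; auto.
- have dpow x : U x -> differentiable (@powR R ^~ p) (f x).
    by move=> /fgt0 fx; apply/derivable1_diffP/derivable_powR; rewrite in_itv /= fx.
  split=> [x Ux|v].
    exact: (@differentiable_comp _ _ _ _ f (@powR R ^~ p)) (df x Ux) (dpow x Ux).
  have [f' ef' Df'] := Df v.
  exists (fun x => p * f x `^ (p - 1) * f' x).
    apply: elementary_mul => //; apply: elementary_mul.
      exact: elementary_cst.
    exact: elementary_powR.
  move=> x Ux; rewrite -Df' // !deriveE; [|exact: df|]; last first.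
    exact: (@differentiable_comp _ _ _ _ f (@powR R ^~ p)) (df x Ux) (dpow x Ux).
  rewrite (@diff_comp _ _ _ _ f (@powR R ^~ p)) //=; [|exact: df|exact: dpow].
  rewrite diff1E; last exact: dpow.
  by rewrite powR_derive1 ?in_itv /= ?fgt0 //; exact: mulrC.
Qed.

(** Induction on [r] for all [F] at once: the components of ['D_v F] again agree on [U] with
    elementary functions. Openness of [U] turns agreement on [U] into agreement near each point,
    which transfers derivatives. *)
Lemma elementary_smooth (R : realType) m n (U : set 'rV[R]_m)
    (F : 'rV[R]_m -> 'rV[R]_n) : open U ->
  (forall i, exists2 f, elementary U f & forall x, U x -> F x 0 i = f x) ->
  smooth_on U F.
Proof.
move=> oU eF r; elim: r F eF => [|r IH] F eF.
all: have dF x : U x -> differentiable F x.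
1,3: move=> Ux; apply: differentiable_row => i; have [f ef Ff] := eF i;
  have [df _] := elementary_derive _ _ _ _ ef;
  apply: (@near_eq_differentiable _ _ _ f) (df x Ux);
  by apply: filterS (open_nbhs_nbhs (conj oU Ux)) => y /Ff.
- by move=> x /dF; exact: differentiable_continuous.
- split=> // v; apply: IH => i.
  have [f ef Ff] := eF i; have [df Df] := elementary_derive _ _ _ _ ef.
  have [f' ef' Df'] := Df v; exists f' => // x Ux.
  rewrite derive_coord; last exact: dF.
  rewrite -Df' //; apply: near_eq_derive.
  exact: filterS (open_nbhs_nbhs (conj oU Ux)).
Qed.

Lemma elementary_sub (R : realType) m (U : set 'rV[R]_m) f g :
  elementary U f -> elementary U g -> elementary U (fun x => f x - g x).
Proof.
move=> ef eg; have -> : (fun x => f x - g x) = (fun x => f x + -1 * g x).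
  by apply/funext => x; rewrite mulN1r.
by apply: elementary_add => //; apply: elementary_mul => //; exact: elementary_cst.
Qed.

Lemma elementary_exp (R : realType) m (U : set 'rV[R]_m) f n :
  elementary U f -> elementary U (fun x => f x ^+ n).
Proof.
move=> ef; elim: n => [|n IH].
  by under eq_fun do rewrite expr0; exact: elementary_cst.
by under eq_fun do rewrite exprS; exact: elementary_mul.
Qed.

(** * Moebius maps and the cyclic system *)

Definition moebius_step (R : realType) (x t : R) : R := x / (1 - x + t).

(** Both sides unfold to [s * (1 - x + t) = x], which is linear in [s]. *)
Lemma moebius_step_eq (R : realType) (x s t : R) :
  0 < x < 1 -> 0 < s -> 0 < t ->
  s = moebius_step R x t <-> s * (1 + t) / (1 + s) = x.
Proof.
move=> /andP[x0 x1] s0 t0; rewrite /moebius_step.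
have d0 : 1 - x + t != 0 by rewrite gt_eqF //; lra.
have d1 : 1 + s != 0 by rewrite gt_eqF //; lra.
split=> [/(canLR (divfK d0)) e|/(canRL (divfK d1)) e].
  apply/(canLR (mulfK d1)); lra.
apply/(canRL (mulfK d0)); lra.
Qed.

Lemma moebius_step_gt0 (R : realType) (x t : R) :
  0 < x < 1 -> 0 < t -> 0 < moebius_step R x t.
Proof. by move=> /andP[x0 x1] t0; rewrite divr_gt0 //; lra. Qed.

(** Adding [i] in front of [l] multiplies the coefficient matrix on the left by the matrix with rows
    [(0, x_i)] and [(1, 1 - x_i)], starting from the identity. The invariants [0 < D] and
    [0 < A + C] make the new [B] and [C] positive. *)
Lemma moebius_coefs (R : realType) k (l : seq 'I_k) :
  exists A B C D : 'rV[R]_k -> R,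
  [/\ elementary (@open_unit_cube R k) A, elementary (@open_unit_cube R k) B,
      elementary (@open_unit_cube R k) C & elementary (@open_unit_cube R k) D] /\
  forall x, open_unit_cube x ->
  [/\ [/\ 0 <= A x, 0 <= B x, 0 <= C x, 0 < D x & 0 < A x + C x],
      l != [::] -> 0 < B x /\ 0 < C x &
      forall t : R, 0 < t ->
        foldr (fun i => moebius_step R (x 0 i)) t l =
        (A x * t + B x) / (C x * t + D x)].
Proof.
elim: l => [|i l [A [B [C [D [[eA eB eC eD] H]]]]]].
  exists (fun=> 1), (fun=> 0), (fun=> 0), (fun=> 1).
  split; first by split; exact: elementary_cst.
  move=> x _; split=> //.
  by move=> t _ /=; rewrite mul1r mul0r addr0 add0r divr1.
have ei := elementary_coord (U := @open_unit_cube R k) i.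
have e1 := elementary_cst (U := @open_unit_cube R k) 1.
have e1i := elementary_sub _ _ _ _ _ e1 ei.
exists (fun x : 'rV_k => x 0 i * C x), (fun x : 'rV_k => x 0 i * D x),
  (fun x : 'rV_k => (1 - x 0 i) * C x + A x),
  (fun x : 'rV_k => (1 - x 0 i) * D x + B x).
split; first by split; do ?apply: elementary_add; do ?apply: elementary_mul.
move=> x Ux; have [[A0 B0 C0 D0 AC0] _ Hx] := H x Ux.
have /andP[x0 x1] := Ux i.
have C'0 : 0 < (1 - x 0 i) * C x + A x by nra.
have D'0 : 0 < (1 - x 0 i) * D x by rewrite mulr_gt0 // subr_gt0.
have B'0 : 0 < x 0 i * D x by rewrite mulr_gt0.
have A'0 : 0 <= x 0 i * C x by rewrite mulr_ge0 // ltW.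
split=> //; first by split; lra.
move=> t t0 /=; rewrite Hx // /moebius_step.
have d1 : C x * t + D x != 0 by rewrite gt_eqF //; nra.
have d2 : ((1 - x 0 i) * C x + A x) * t + ((1 - x 0 i) * D x + B x) != 0.
  by rewrite gt_eqF //; nra.
field; rewrite d1 /= andbT.
by rewrite (_ : _ + _ = ((1 - x 0 i) * C x + A x) * t + ((1 - x 0 i) * D x + B x)) //; ring.
Qed.

Lemma norm_lt_sqrt_disc (R : realType) (b c d : R) :
  0 < b -> 0 < c -> `|d| < Num.sqrt (d ^+ 2 + 4 * (b * c)).
Proof.
move=> b0 c0; have bc0 : 0 < b * c by rewrite mulr_gt0.
by rewrite -sqrtr_sqr ltr_sqrt ?ltrDl //; nra.
Qed.

(** With [S] the root of the discriminant, [4 * c] times the quadratic is [(2 * c * t - (S - d)) *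
    (2 * c * t + d + S)]. The second factor is positive because [|d| < S]. *)
Lemma positive_quadratic_root (R : realType) (b c d t : R) :
  0 < b -> 0 < c -> 0 < t ->
  c * t ^+ 2 + d * t - b = 0 <->
  t = (Num.sqrt (d ^+ 2 + 4 * (b * c)) - d) / (2 * c).
Proof.
move=> b0 c0 t0; set S := Num.sqrt _.
have bc0 : 0 < b * c by rewrite mulr_gt0.
have := norm_lt_sqrt_disc _ _ _ d b0 c0; rewrite ltr_norml -/S => /andP[? ?].
have S2 : S ^+ 2 = d ^+ 2 + 4 * (b * c) by rewrite sqr_sqrtr //; nra.
have c2 : 2 * c != 0 by rewrite gt_eqF //; lra.
have fac : 4 * c * (c * t ^+ 2 + d * t - b) = (t * (2 * c) - (S - d)) * (2 * c * t + d + S).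
  by transitivity (4 * c * (c * t ^+ 2 + d * t) + d ^+ 2 - S ^+ 2); [rewrite S2|]; ring.
split=> [e|/(canLR (divfK c2)) e].
  apply/(canRL (mulfK c2))/eqP; rewrite -subr_eq0.
  move/eqP : fac; rewrite e mulr0 eq_sym mulf_eq0 => /orP[//|/eqP]; nra.
apply/eqP; move/eqP: fac; rewrite e subrr mul0r !mulf_eq0 pnatr_eq0 /=.
by rewrite (gt_eqF c0).
Qed.

(* The fixed points of a Moebius map solve a quadratic equation, whose product
   of roots [- B / C] is negative here. *)
Lemma moebius_fixpoint (R : realType) k (l : seq 'I_k) : l != [::] ->
  exists2 r : 'rV[R]_k -> R, elementary (@open_unit_cube R k) r &
  forall x, open_unit_cube x -> 0 < r x /\
    forall t : R, 0 < t ->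
      (foldr (fun i => moebius_step R (x 0 i)) t l = t <-> t = r x).
Proof.
move=> l0; have [A [B [C [D [[eA eB eC eD] H]]]]] := moebius_coefs R k l.
pose disc x := (D x - A x) ^+ 2 + 4 * (B x * C x).
(* The quadratic formula, with root and quotient written as real powers so that [r] is visibly
   elementary. *)
pose r x := (disc x `^ (2^-1) - (D x - A x)) * (2 * C x) `^ (-1).
have disc0 x : open_unit_cube x -> 0 < disc x.
  move=> Ux; have [_ /(_ l0) [B0 C0] _] := H x Ux.
  by rewrite ltr_wpDl ?sqr_ge0 // !mulr_gt0.
have C20 x : open_unit_cube x -> 0 < 2 * C x.
  by move=> Ux; have [_ /(_ l0) [B0 C0] _] := H x Ux; rewrite mulr_gt0.
have ecst c := elementary_cst (U := @open_unit_cube R k) c.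
exists r.
  apply: elementary_mul; last by apply: elementary_powR => //; exact: elementary_mul.
  apply: elementary_sub; last exact: elementary_sub.
  apply: elementary_powR => //; apply: elementary_add.
    by apply: elementary_exp; exact: elementary_sub.
  by do 2 apply: elementary_mul => //.
move=> x Ux; have [[A0 B0' C0' D0 _] /(_ l0) [B0 C0] Hx] := H x Ux.
have rE : r x = (Num.sqrt (disc x) - (D x - A x)) / (2 * C x).
  by rewrite /r powR12_sqrt ?powR_inv1 // ltW ?disc0 ?C20.
have fixE t : 0 < t ->
    foldr (fun i => moebius_step R (x 0 i)) t l = t <-> t = r x.
  move=> t0; rewrite Hx // rE.
  (* Clearing the denominator, the fixed-point equation is [C * t ^ 2 + (D - A) * t - B = 0]. *)
  rewrite -(@positive_quadratic_root R (B x) (C x) (D x - A x)) //.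
  have d0 : C x * t + D x != 0 by rewrite gt_eqF //; nra.
  split=> [/(canRL (divfK d0)) e|e]; first by nra.
  by apply/(canLR (mulfK d0)); nra.
split=> //; rewrite rE divr_gt0 ?C20 // subr_gt0.
apply: le_lt_trans (norm_lt_sqrt_disc _ _ _ _ B0 C0); exact: ler_norm.
Qed.

Lemma iter_ordS k (i : 'I_k) : iter k (@ordS k) i = i.
Proof.
have valE n : (iter n (@ordS k) i : nat) = ((i + n) %% k)%N.
  elim: n => [|n IH]; first by rewrite addn0 modn_small.
  by rewrite iterS /= IH -addn1 modnDml addn1 addnS.
by apply: val_inj; rewrite /= valE modnDr modn_small.
Qed.

(** [r i] is the fixed point of the composition once around the cycle from [i]. The equations will
    give surjectivity of the change of variables, uniqueness its injectivity, and elementarity the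
    smoothness of the inverse. *)
Lemma moebius_system (R : realType) k : exists r : 'I_k -> 'rV[R]_k -> R,
  (forall i, elementary (@open_unit_cube R k) (r i)) /\
  forall x, open_unit_cube x ->
  [/\ forall i, 0 < r i x,
      forall i, r i x = moebius_step R (x 0 i) (r (ordS i) x) &
      forall u : 'I_k -> R, (forall i, 0 < u i) ->
        (forall i, u i = moebius_step R (x 0 i) (u (ordS i))) ->
        forall i, u i = r i x].
Proof.
case: k => [|k].
  by exists (fun _ _ => 1); split=> [[]//|x _]; split=> [[]//|[]//|u _ _ []].
have trajS (i : 'I_k.+1) : traject (@ordS _) i k.+1 != [::] by [].
pose r i := s2val (cid2 (moebius_fixpoint R _ _ (trajS i))).
have er i : elementary (@open_unit_cube R k.+1) (r i).
  exact: s2valP (cid2 (moebius_fixpoint R _ _ (trajS i))).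
exists r; split=> // x Ux.
have fixr i : 0 < r i x /\ forall t : R, 0 < t ->
    foldr (fun i => moebius_step R (x 0 i)) t (traject (@ordS _) i k.+1) = t <->
    t = r i x.
  exact: (s2valP' (cid2 (moebius_fixpoint R _ _ (trajS i)))).
split=> [i|i|u u0 uE i]; first by case: (fixr i).
- have [r0 fixi] := fixr i; have [rS0 fixS] := fixr (ordS i).
  apply/esym/fixi; first exact: moebius_step_gt0.
  have <- : foldr (fun i => moebius_step R (x 0 i)) (r (ordS i) x)
      (rcons (traject (@ordS _) i k.+1) i) =
    foldr (fun i => moebius_step R (x 0 i)) (moebius_step R (x 0 i) (r (ordS i) x))
      (traject (@ordS _) i k.+1) by rewrite foldr_rcons.
  (* The loop from [i] followed by [i] is [i] followed by the loop from [ordS i], so the step at [i]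
     carries a fixed point of the second loop to one of the first. *)
  have -> : rcons (traject (@ordS _) i k.+1) i = i :: traject (@ordS _) (ordS i) k.+1.
    by rewrite -trajectS [RHS]trajectSr iter_ordS.
  by move: ((fixS (r (ordS i) x) rS0).2 erefl) => /= ->.
- have [r0 fixi] := fixr i; apply/fixi => //.
  (* Unrolling the equations [n] times from [j]; a full turn makes [u i] a fixed point. *)
  have folds n j : foldr (fun i => moebius_step R (x 0 i))
      (u (iter n (@ordS _) j)) (traject (@ordS _) j n) = u j.
    by elim: n j => //= n IH j; rewrite -iterS iterSr IH -uE.
  by have := folds k.+1 i; rewrite iter_ordS.
Qed.

(** * The polytope as the preimage of the cube, and openness of both *)

Lemma change_of_variables_bound (R : realType) (u v : R) :
  0 < u -> 0 < v -> 0 < u * (1 + v) / (1 + u) < 1 <-> u * v < 1.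
Proof.
move=> u0 v0; have u1 : 0 < 1 + u by lra.
rewrite divr_gt0 ?mulr_gt0 //=; last by lra.
rewrite ltr_pdivrMr //; split; lra.
Qed.

(** The scalar bound applies to [u = xi_i ^ a] and [v = xi_(i+1) ^ a], and [u * v < 1] iff
    [xi_i * xi_(i+1) < 1] by monotonicity of powers on nonnegative numbers. *)
Lemma hyperbolic_polytopeE (R : realType) a k (xi : 'rV[R]_k) : (0 < a)%N ->
  (forall i, 0 < xi 0 i) ->
  hyperbolic_polytope xi <-> open_unit_cube (change_of_variables a xi).
Proof.
move=> a0 xi0; split=> H i; have := H i; rewrite ?mxE.
  move=> [lt1 _]; apply/change_of_variables_bound; rewrite ?exprn_gt0 //.
  by rewrite -exprMn exprn_ilt1 ?mulr_ge0 ?ltW // -lt0n.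
move=> /change_of_variables_bound; rewrite !exprn_gt0 // -exprMn => /(_ isT isT).
by rewrite expr_lt1 // ?mulr_ge0 ?ltW.
Qed.

Lemma open_hyperbolic_polytope (R : realType) k :
  open (@hyperbolic_polytope R k).
Proof.
rewrite openE => x Ux; rewrite /interior.
have cont i : {for x, continuous (fun y : 'rV[R]_k => y 0 i)}.
  exact: coord_continuous.
apply: (@filter_forall _ _ _ (nbhs x)) => i; have [lt1 gt0] := Ux i.
apply: filterI; last exact: (cvgr_gt _ (cont i)).
exact: (cvgr_lt _ (cvgM (cont i) (cont (ordS i)))).
Qed.

Lemma open_open_unit_cube (R : realType) k : open (@open_unit_cube R k).
Proof.
rewrite openE => x Ux; rewrite /interior.
apply: (@filter_forall _ _ _ (nbhs x)) => i; have /andP[gt0 lt1] := Ux i.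
have cont : {for x, continuous (fun y : 'rV[R]_k => y 0 i)}.
  exact: coord_continuous.
near=> y; apply/andP; split; near: y.
  exact: (cvgr_gt _ cont).
exact: (cvgr_lt _ cont).
Unshelve. all: by end_near. Qed.

(** * The diffeomorphism *)

Lemma exprn_powRV (R : realType) (a : nat) (x : R) :
  (0 < a)%N -> 0 <= x -> (x ^+ a) `^ (a%:R^-1) = x.
Proof.
move=> a0 x0; rewrite -powR_mulrn // -powRrM divff ?powRr1 //.
by rewrite pnatr_eq0 -lt0n.
Qed.

Lemma powRV_exprn (R : realType) (a : nat) (x : R) :
  (0 < a)%N -> 0 <= x -> (x `^ (a%:R^-1)) ^+ a = x.
Proof.
move=> a0 x0; rewrite -powR_mulrn ?powR_ge0 // -powRrM mulVf ?powRr1 //.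
by rewrite pnatr_eq0 -lt0n.
Qed.

Lemma change_of_variables_smooth (R : realType) a k :
  smooth_on (@hyperbolic_polytope R k) (@change_of_variables R a k).
Proof.
apply: elementary_smooth => [|i]; first exact: open_hyperbolic_polytope.
pose U := @hyperbolic_polytope R k.
have e1 := elementary_cst (U := U) 1.
have eu j : elementary U (fun xi => xi 0 j ^+ a).
  by apply: elementary_exp; exact: elementary_coord.
have u0 x j : U x -> 0 < 1 + x 0 j ^+ a.
  by move=> /(_ j)[_ xj]; rewrite addr_gt0 // exprn_gt0.
(* The quotient is rewritten as a power with exponent [-1] of a base positive on the polytope. *)
exists (fun xi => xi 0 i ^+ a * (1 + xi 0 (ordS i) ^+ a) *
                  (1 + xi 0 i ^+ a) `^ (-1)).
  apply: elementary_mul; first by apply: elementary_mul => //; exact: elementary_add.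
  by apply: elementary_powR => [|x Ux]; [exact: elementary_add|exact: u0].
by move=> x Ux; rewrite mxE powR_inv1 // ltW // u0.
Qed.

(** The inverse [g] takes [a]-th roots of the solution of the Moebius system: uniqueness of that
    solution gives [fK], the equations themselves give [gK]. *)
Lemma change_of_variables_diffeomorphism (R : realType) a k : (0 < a)%N ->
  diffeomorphism (@hyperbolic_polytope R k) (@open_unit_cube R k)
    (@change_of_variables R a k).
Proof.
move=> a0; have [r [er rP]] := moebius_system R k.
pose g (x : 'rV[R]_k) : 'rV[R]_k := \row_i (r i x `^ (a%:R^-1)).
have fU (xi : 'rV[R]_k) : hyperbolic_polytope xi -> open_unit_cube (change_of_variables a xi).
  by move=> Hxi; apply/hyperbolic_polytopeE => // i; case: (Hxi i).
have fK (xi : 'rV[R]_k) : hyperbolic_polytope xi -> g (change_of_variables a xi) = xi.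
  move=> Hxi; have Ux := fU xi Hxi; have [r0 _ uniq] := rP _ Ux.
  have xi0 i : 0 < xi 0 i by case: (Hxi i).
  apply/rowP => i; rewrite mxE -(uniq (fun i => xi 0 i ^+ a)).
  - by rewrite exprn_powRV // ltW.
  - by move=> j; rewrite exprn_gt0.
  - by move=> j; apply/moebius_step_eq; rewrite ?exprn_gt0 // mxE.
have g0 (x : 'rV[R]_k) i : open_unit_cube x -> 0 < g x 0 i.
  by move=> Ux; rewrite mxE powR_gt0 //; have [] := rP x Ux.
have gK (x : 'rV[R]_k) : open_unit_cube x -> change_of_variables a (g x) = x.
  move=> Ux; have [r0 rE _] := rP x Ux.
  apply/rowP => i; rewrite !mxE !powRV_exprn ?(ltW (r0 _)) //.
  by apply/moebius_step_eq.
split; [exact: open_hyperbolic_polytope|exact: open_open_unit_cube| |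
        exact: change_of_variables_smooth|exists g => //].
- split=> [x /fU //|x y /set_mem Hx /set_mem Hy fxy|x Ux].
    by rewrite -(fK x) // -(fK y) // fxy.
  exists (g x); last exact: gK.
  (* [g x] has positive coordinates and its image [x] lies in the cube, hence it lies in the
     polytope. *)
  by apply/(@hyperbolic_polytopeE R a) => // [i|]; rewrite ?gK //; exact: g0.
- apply: elementary_smooth => [|i]; first exact: open_open_unit_cube.
  exists (fun x => r i x `^ (a%:R^-1)); last by move=> x _; rewrite mxE.
  by apply: elementary_powR => // x Ux; have [] := rP x Ux.
Qed.

(** * The Jacobian matrix and its determinant *)

(** A derivative along an arbitrary [v] needs no case distinction: when [k = 1], [i] and [ordS i]
    coincide and the two terms simply add up. The exponent [a.+1] avoids truncated subtraction. *)
Lemma change_of_variables_derive (R : realType) a k (xi v : 'rV[R]_k) i :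
  1 + xi 0 i ^+ a.+1 != 0 ->
  differentiable (fun y => change_of_variables a.+1 y 0 i) xi /\
  'D_v (fun y => change_of_variables a.+1 y 0 i) xi =
    v 0 i * (a.+1%:R * xi 0 i ^+ a * (1 + xi 0 (ordS i) ^+ a.+1)
             / (1 + xi 0 i ^+ a.+1) ^+ 2) +
    v 0 (ordS i) * (a.+1%:R * xi 0 (ordS i) ^+ a * xi 0 i ^+ a.+1
                    / (1 + xi 0 i ^+ a.+1)).
Proof.
move=> nz.
pose u j : 'rV[R]_k -> R := fun y => y 0 j.
have du j : differentiable (u j) xi by exact: differentiable_coord.
have Du j : is_derive xi v (u j) (v 0 j).
  by split; [exact: diff_derivable|exact: derive_coordE].
pose p j : 'rV[R]_k -> R := cst 1 + u j ^+ a.+1.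
have pE j y : p j y = 1 + y 0 j ^+ a.+1 by rewrite /p !fctE.
have dp j : differentiable (p j) xi.
  by apply: differentiableD; [exact: differentiable_cst|exact: differentiableX].
have Dp j : is_derive xi v (p j) (a.+1%:R * xi 0 j ^+ a * v 0 j).
  by apply: is_derive_eq; rewrite add0r.
have pi0 : p i xi != 0 by rewrite pE.
have fE : (fun y => change_of_variables a.+1 y 0 i) =
    u i ^+ a.+1 * p (ordS i) * (fun y => (p i y)^-1).
  by apply/funext => y; rewrite !mxE !fctE !pE.
rewrite fE; split.
  apply: differentiableM; last exact: differentiableV.
  by apply: differentiableM => //; exact: differentiableX.
have DV : is_derive xi v (fun y => (p i y)^-1)
    (- (p i xi) ^- 2 * (a.+1%:R * xi 0 i ^+ a * v 0 i)).
  split; first by apply: derivableV => //; exact: diff_derivable.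
  by rewrite deriveV ?derive_val //; exact: diff_derivable.
rewrite derive_val !fctE !pE /GRing.scale /= /u.
by field.
Qed.

Lemma change_of_variables_jacobian (R : realType) a k (xi : 'rV[R]_k) :
  (forall i, 1 + xi 0 i ^+ a.+1 != 0) ->
  ('J (@change_of_variables R a.+1 k) xi)^T = \matrix_(i, j)
    ((i == j)%:R * (a.+1%:R * xi 0 i ^+ a * (1 + xi 0 (ordS i) ^+ a.+1)
             / (1 + xi 0 i ^+ a.+1) ^+ 2) +
     (j == ordS i)%:R * (a.+1%:R * xi 0 (ordS i) ^+ a * xi 0 i ^+ a.+1
                    / (1 + xi 0 i ^+ a.+1))).
Proof.
move=> nz.
have df : differentiable (@change_of_variables R a.+1 k) xi.
  by apply: differentiable_row => i; have [] := change_of_variables_derive _ _ _ _ 0 _ (nz i).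
apply/matrixP => i j; rewrite !mxE -deriveE // derive_coord //.
have [_ ->] := change_of_variables_derive _ _ _ _ (delta_mx 0 j) _ (nz i).
by rewrite !mxE !eqxx /= [ordS i == j]eq_sym.
Qed.

(** Products over the cycle are invariant under [ordS]. With [X] and [P] as below, the diagonal
    product is [a.+1 ^ k.+1 * X ^ a / P], and the off-diagonal one is this times [X ^ a.+1]. *)
Lemma det_change_of_variables (R : realType) a k (xi : 'rV[R]_k.+1) :
  (forall i, 1 + xi 0 i ^+ a.+1 != 0) ->
  \det ('J (@change_of_variables R a.+1 k.+1) xi)^T =
    a.+1%:R ^+ k.+1 * (\prod_i xi 0 i) ^+ a / (\prod_i (1 + xi 0 i ^+ a.+1)) *
    (1 - (- 1) ^+ k.+1 * (\prod_i xi 0 i) ^+ a.+1).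
Proof.
move=> nz; rewrite change_of_variables_jacobian // det_cyclic_bidiagonal.
have reindexS (F : 'I_k.+1 -> R) : \prod_i F (ordS i) = \prod_i F i.
  by rewrite [RHS](reindex_inj (@ordS_inj _)).
rewrite !big_split /= !prodfV !prodrXl !prodr_const !card_ord.
rewrite (reindexS (fun i => xi 0 i)) (reindexS (fun i => 1 + xi 0 i ^+ a.+1)).
set P := \prod_i (1 + xi 0 i ^+ a.+1); set X := \prod_i xi 0 i.
have P0 : P != 0 by apply/prodf_neq0 => i _.
rewrite -[LHS]/(a.+1%:R ^+ k.+1 * X ^+ a * P / P ^+ 2 +
  (-1) ^+ k * (a.+1%:R ^+ k.+1 * X ^+ a * X ^+ a.+1 / P)) !exprS.
by field.
Qed.

(* ['J f p] has the partial derivative of the j-th component of f along the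
   i-th variable at position (i, j), hence the transpose. *)
Theorem theorem2p2p1 (R : realType) (a k : nat) (ha : (2 <= a)%N)
    (hk : (1 <= k)%N) :
  (forall xi : 'rV[R]_k, (forall i, 1 + xi 0 i ^+ a != 0) ->
     \det ('J (@change_of_variables R a k) xi)^T =
       if k == 1%N then a%:R * xi 0 (Ordinal hk) ^+ (a - 1)
       else a%:R ^+ k * (\prod_i xi 0 i) ^+ (a - 1)
              / (\prod_i (1 + xi 0 i ^+ a))
              * (1 - (- 1) ^+ k * (\prod_i xi 0 i) ^+ a))
  /\ diffeomorphism (@hyperbolic_polytope R k) (@open_unit_cube R k)
       (@change_of_variables R a k).
Proof.
split; last by apply: change_of_variables_diffeomorphism; exact: leq_trans ha.
case: a ha => [//|a] _; case: k hk => [//|k] hk xi nz.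
rewrite det_change_of_variables // subn1 /=; case: k => [|//] in hk xi nz *.
have nz0 := nz (Ordinal hk).
rewrite !big_ord1 (_ : ord0 = Ordinal hk); last exact: val_inj.
(* For [k = 1] the last factor is [1 + xi_1 ^ a] and cancels the denominator. *)
by rewrite !expr1 mulN1r opprK mulfVK.
Qed.
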